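(* Let $m\ge 1$ and $1\le p<\infty$. Then $(S_0^{m,p}, d_p)$ is the completion of $(S_0^{m}, d_p)$.
   Context: $H$ is the Hausdorff metric on nonempty closed subsets of $\mathbb{R}^m$ (Euclidean distance): $H(A,B)=\max\{\sup_{a\in A}\inf_{b\in B}d(a,b),\ \sup_{b\in B}\inf_{a\in A}d(a,b)\}$ (possibly $+\infty$). A fuzzy set on $\mathbb{R}^m$ is a function $u:\mathbb{R}^m\to[0,1]$; its cuts are $[u]_\alpha=\{x: u(x)\ge\alpha\}$ for $\alpha\in(0,1]$ and $[u]_0=\overline{\{x: u(x)>0\}}$. $S_0^{m}$ (fuzzy star-shaped numbers with respect to the origin) is the set of fuzzy sets $u$ that are normal ($u(x_0)=1$ for some $x_0$), upper semi-continuous, have $[u]_0$ bounded, and satisfy $u(\lambda y)\ge u(y)$ for all $y\in\mathbb{R}^m$ and $\lambda\in[0,1]$. $S_0^{m,p}$ is defined in the same way, with the condition ''$[u]_0$ bounded'' replaced by $\left(\int_0^1 H([u]_\alpha,\{0\})^p\,d\alpha\right)^{1/p}<+\infty$, where $0$ is the origin; so $S_0^m\subset S_0^{m,p}$. The metric on both is $d_p(u,v)=\left(\int_0^1 H([u]_\alpha,[v]_\alpha)^p\,d\alpha\right)^{1/p}$. A metric space $Y$ is the completion of a subspace $X\subset Y$ if $Y$ is complete and $X$ is dense in $Y$. *)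

(* Defs.v *)
From HB Require Import structures.
From mathcomp Require Import all_boot all_order all_algebra.
From mathcomp Require Import all_classical all_reals all_analysis.
Import Order.TTheory GRing.Theory Num.Theory.
Import numFieldNormedType.Exports.

Set Implicit Arguments.
Unset Strict Implicit.
Unset Printing Implicit Defensive.

Local Open Scope classical_set_scope.
Local Open Scope ring_scope.

(* The canonical norm of 'rV[R]_m is the sup norm; it induces the same topology
   and the same bounded sets as the Euclidean distance, so closure,
   semicontinuity and boundedness below use the canonical structures. *)
Definition eucl_dist (R : realType) (m : nat) (x y : 'rV[R]_m) : R :=
  Num.sqrt (\sum_(i < m) (x ord0 i - y ord0 i) ^+ 2).

Definition hausdorff_dist (R : realType) (m : nat) (A B : set 'rV[R]_m)
    : \bar R :=
  maxe (ereal_sup [set ereal_inf [set (eucl_dist a b)%:E | b in B] | a in A])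
       (ereal_sup [set ereal_inf [set (eucl_dist a b)%:E | a in A] | b in B]).

Definition fuzzy_set (R : realType) (m : nat) (u : 'rV[R]_m -> R) : Prop :=
  forall x, 0 <= u x <= 1.

(* Only used for alpha in [0, 1]. *)
Definition fuzzy_cut (R : realType) (m : nat) (u : 'rV[R]_m -> R) (alpha : R)
    : set 'rV[R]_m :=
  if alpha == 0 then closure [set x | 0 < u x] else [set x | alpha <= u x].

Definition normal_fuzzy (R : realType) (m : nat) (u : 'rV[R]_m -> R) : Prop :=
  exists x0, u x0 = 1.

Definition upper_semicontinuous (X : topologicalType) (R : realType)
    (u : X -> R) : Prop :=
  lower_semicontinuous (fun x => (- u x)%:E).

Definition star_shaped0 (R : realType) (m : nat) (u : 'rV[R]_m -> R) : Prop :=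
  forall (y : 'rV[R]_m) (lambda : R), 0 <= lambda <= 1 ->
    u y <= u (lambda *: y).

Definition Lp_hausdorff_dist (R : realType) (m : nat) (p : R)
    (A B : R -> set 'rV[R]_m) : \bar R :=
  poweR (\int[@lebesgue_measure R]_(alpha in `[0%R, 1%R])
           poweR (hausdorff_dist (A alpha) (B alpha)) p)%E p^-1.

Definition fuzzy_dp (R : realType) (m : nat) (p : R) (u v : 'rV[R]_m -> R)
    : \bar R :=
  Lp_hausdorff_dist p (fuzzy_cut u) (fuzzy_cut v).

Definition S0m (R : realType) (m : nat) : set ('rV[R]_m -> R) :=
  [set u | [/\ fuzzy_set u, normal_fuzzy u, upper_semicontinuous u,
               bounded_set (fuzzy_cut u 0) & star_shaped0 u]].

Definition S0mp (R : realType) (m : nat) (p : R) : set ('rV[R]_m -> R) :=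
  [set u | [/\ fuzzy_set u, normal_fuzzy u, upper_semicontinuous u,
               (Lp_hausdorff_dist p (fuzzy_cut u) (fun=> [set 0%R]) < +oo)%E
             & star_shaped0 u]].

Definition metric_on (R : realType) (T : Type) (S : set T)
    (d : T -> T -> \bar R) : Prop :=
  [/\ forall x y, S x -> S y -> (0 <= d x y < +oo)%E,
      forall x y, S x -> S y -> d x y = 0%E <-> x = y,
      forall x y, S x -> S y -> d x y = d y x
    & forall x y z, S x -> S y -> S z -> (d x z <= d x y + d y z)%E].

(* The carrier is a fresh alias so that it does not inherit the topology that
   [set_type S] gets from a topology on T. *)
Definition metric_space (R : realType) (T : Type) (S : set T)
  (d : T -> T -> \bar R) (dS : metric_on S d) : Type := {x : T | x \in S}.

Section metric_space_instance.
Context (R : realType) (T : Type) (S : set T) (d : T -> T -> \bar R).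
Variable dS : metric_on S d.
Local Notation M := (metric_space dS).

Definition metric_val (x : M) : T := proj1_sig x.

Definition metric_dist (x y : M) : R := fine (d (metric_val x) (metric_val y)).

Lemma metric_valP (x : M) : S (metric_val x).
Proof. by case: x => x xS /=; apply: set_mem. Qed.

Lemma metric_dist_fin (x y : M) :
  d (metric_val x) (metric_val y) \is a fin_num.
Proof.
have [dfin _ _ _] := dS.
have /andP[d0 doo] := dfin _ _ (metric_valP x) (metric_valP y).
by rewrite ge0_fin_numE.
Qed.

Lemma metric_distE (x y : M) :
  (metric_dist x y)%:E = d (metric_val x) (metric_val y).
Proof. by rewrite fineK// metric_dist_fin. Qed.

Lemma metric_distxx x : metric_dist x x = 0.
Proof.
have [_ d0 _ _] := dS.
apply: EFin_inj; rewrite metric_distE.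
by apply/(d0 _ _ (metric_valP x) (metric_valP x)).
Qed.

Lemma metric_dist_eq0 x y : metric_dist x y = 0 -> x = y.
Proof.
have [_ d0 _ _] := dS => xy0.
have : metric_val x = metric_val y.
  apply/(d0 _ _ (metric_valP x) (metric_valP y)).
  by rewrite -metric_distE xy0.
case: x {xy0} => x xS; case: y => y yS; rewrite /metric_val /= => xy.
by subst y; rewrite (Prop_irrelevance xS yS).
Qed.

Lemma metric_dist_sym x y : metric_dist x y = metric_dist y x.
Proof.
have [_ _ dC _] := dS.
by apply: EFin_inj; rewrite !metric_distE dC//; exact: metric_valP.
Qed.

Lemma metric_dist_triangle y x z :
  metric_dist x z <= metric_dist x y + metric_dist y z.
Proof.
have [_ _ _ dtri] := dS.
by rewrite -lee_fin EFinD !metric_distE; apply: dtri; exact: metric_valP.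
Qed.

HB.instance Definition _ := gen_eqMixin M.
HB.instance Definition _ := gen_choiceMixin M.
HB.instance Definition _ := @isMetric.Build R M metric_dist metric_distxx
  metric_dist_eq0 metric_dist_sym metric_dist_triangle.

End metric_space_instance.

(* Completeness is the axiom of [completeType], stated without requiring a
   pointed carrier. *)
Definition is_completion (R : realType) (Y : metricType R) (X : set Y)
    : Prop :=
  (forall F : set_system Y, ProperFilter F -> cauchy F ->
     exists y : Y, F --> y) /\
  dense X.

(* Main.v *)
Require Import Defs.
From mathcomp Require Import all_boot all_order all_algebra.
From mathcomp Require Import all_classical all_reals all_analysis.
From mathcomp Require Import measurable_realfun.
From mathcomp Require Import ring lra.
Import Order.TTheory GRing.Theory Num.Theory.
Import numFieldNormedType.Exports.
Local Open Scope classical_set_scope.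
Local Open Scope ring_scope.

(** For upper semi-continuous [u] and [v] the function
    [a |-> H([u]_a, [v]_a)] satisfies a one-sided lower semi-continuity from the
    left, by compactness of Euclidean balls; hence it is measurable on ]0, 1],
    Minkowski's inequality makes d_p a metric, and functions that vanish almost
    everywhere vanish everywhere.

    Density: replacing the values of [u] below [1/(n+1)] by [0] gives elements
    of S_0^m; [H([u]_a, {0})^p] dominates the p-th power of the distance between
    cuts, which is eventually [0] for each [a].

    Completeness: it is enough to treat a sequence with
    [d_p(u_n, u_(n+1)) <= 4^-n]. If [f_n a := H([u_n]_a, [u_(n+1)]_a)], then the
    function [S := \sum_n (2^n f_n)^p] has integral at most [2]; wherever [S a]
    is finite the sets [u_n]_a converge geometrically to their lower limit
    [L a], with [H(L a, [u_n]_a)^p <= (2/2^n)^p S a]. The limit of the sequence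
    is the fuzzy set [x |-> sup {a | x \in L a}], whose cuts coincide with the
    decreasing family [L] outside a countable set of jumps. *)

(** * Euclidean distance *)

Section euclidean_distance.
Context {R : realType} {m : nat}.
Implicit Types x y z : 'rV[R]_m.

(** The nonnegative sum of the squares of [a i * t - b i * c] equals [t * (s * t - c ^+ 2)], so a
    positive [t] can be divided out; if [t] is zero, every [b i] vanishes. *)
Lemma sum_cauchy_schwarz (a b : 'I_m -> R) :
  (\sum_i a i * b i) ^+ 2 <= (\sum_i a i ^+ 2) * (\sum_i b i ^+ 2).
Proof.
set c := \sum_i a i * b i; set s := \sum_i a i ^+ 2; set t := \sum_i b i ^+ 2.
have t0 : 0 <= t by apply: sumr_ge0 => i _; exact: sqr_ge0.
have : 0 <= \sum_i (a i * t - b i * c) ^+ 2.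
  by apply: sumr_ge0 => i _; exact: sqr_ge0.
have -> : \sum_i (a i * t - b i * c) ^+ 2 = t * (s * t - c ^+ 2).
  transitivity (\sum_i (t ^+ 2 * a i ^+ 2 + (- (2 * t * c)) * (a i * b i)
                        + c ^+ 2 * b i ^+ 2)).
    by apply: eq_bigr => i _; ring.
  by rewrite !big_split/= -!mulr_sumr -/s -/t -/c; ring.
have [t_eq0 _|t_neq0] := eqVneq t 0.
  have b0 i : b i = 0.
    apply/eqP; rewrite -sqrf_eq0; apply/eqP.
    by apply: (psumr_eq0P _ t_eq0) => // j _; exact: sqr_ge0.
  by rewrite t_eq0 mulr0 /c big1 ?expr0n// => i _; rewrite b0 mulr0.
by rewrite pmulr_rge0 ?subr_ge0// lt_def t_neq0.
Qed.

Lemma eucl_dist_ge0 x y : 0 <= eucl_dist x y.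
Proof. exact: sqrtr_ge0. Qed.

Lemma eucl_distxx x : eucl_dist x x = 0.
Proof.
by rewrite /eucl_dist big1 ?sqrtr0// => i _; rewrite subrr expr0n.
Qed.

Lemma eucl_distC x y : eucl_dist x y = eucl_dist y x.
Proof.
by congr Num.sqrt; apply: eq_bigr => i _; rewrite -sqrrN opprB.
Qed.

Lemma eucl_dist_triangle y x z :
  eucl_dist x z <= eucl_dist x y + eucl_dist y z.
Proof.
rewrite -(ler_pXn2r (n := 2))// ?nnegrE ?addr_ge0 ?eucl_dist_ge0//.
pose a i := x ord0 i - y ord0 i; pose b i := y ord0 i - z ord0 i.
have S0 : 0 <= \sum_i a i ^+ 2 by apply: sumr_ge0 => i _; exact: sqr_ge0.
have T0 : 0 <= \sum_i b i ^+ 2 by apply: sumr_ge0 => i _; exact: sqr_ge0.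
have -> : eucl_dist x z ^+ 2 =
    \sum_i a i ^+ 2 + (\sum_i a i * b i) *+ 2 + \sum_i b i ^+ 2.
  rewrite sqr_sqrtr; last by apply: sumr_ge0 => i _; exact: sqr_ge0.
  rewrite -sumrMnl -!big_split/=; apply: eq_bigr => i _.
  by rewrite -sqrrD /a /b addrA subrK.
rewrite sqrrD !sqr_sqrtr// lerD2r lerD2l lerMn2r/=.
rewrite -sqrtrM// (le_trans (ler_norm _))// -sqrtr_sqr ler_wsqrtr//.
exact: sum_cauchy_schwarz.
Qed.

Lemma ler_coord_eucl_dist x y i : `|x ord0 i - y ord0 i| <= eucl_dist x y.
Proof.
rewrite -sqrtr_sqr ler_wsqrtr// (bigD1 i)//= lerDl.
by apply: sumr_ge0 => j _; exact: sqr_ge0.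
Qed.

Lemma eucl_dist_eq0 x y : eucl_dist x y = 0 -> x = y.
Proof.
move=> xy0; apply/rowP => i; apply/eqP; rewrite -subr_eq0 -normr_le0 -xy0.
exact: ler_coord_eucl_dist.
Qed.

Lemma ler_norm_eucl_dist x y : `|x - y| <= eucl_dist x y.
Proof.
rewrite [leLHS]/Num.norm/= mx_normrE; apply: bigmax_le.
  exact: eucl_dist_ge0.
by move=> [i j] _ /=; rewrite (ord1 i) !mxE; exact: ler_coord_eucl_dist.
Qed.

Lemma ler_eucl_dist_norm x y : eucl_dist x y <= m%:R * `|x - y|.
Proof.
have mxy0 : 0 <= m%:R * `|x - y| by rewrite mulr_ge0.
rewrite -(ler_pXn2r (n := 2))// ?nnegrE ?eucl_dist_ge0//.
rewrite sqr_sqrtr; last by apply: sumr_ge0 => i _; exact: sqr_ge0.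
apply: (@le_trans _ _ (\sum_(i < m) `|x - y| ^+ 2)).
  apply: ler_sum => i _; rewrite -real_normK ?num_real// lerXn2r ?nnegrE//.
  rewrite [leRHS]/Num.norm/= mx_normrE; apply/bigmax_geP; right.
  by exists (ord0, i); rewrite //= !mxE.
rewrite sumr_const card_ord exprMn -[leLHS]mulr_natl ler_wpM2r ?sqr_ge0//.
by rewrite -natrX ler_nat; case: (m) => // k; rewrite expnS leq_pmulr.
Qed.

Lemma eucl_dist_scale (l : R) x y : 0 <= l <= 1 ->
  eucl_dist (l *: x) (l *: y) <= eucl_dist x y.
Proof.
move=> /andP[l0 l1]; rewrite ler_wsqrtr//; apply: ler_sum => i _.
rewrite !mxE -mulrBr exprMn ler_piMl ?sqr_ge0//.
by rewrite expr_le1.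
Qed.

(** The bridge from the canonical sup-norm topology to Euclidean distance: each of the two is
    bounded by a constant multiple of the other. *)
Lemma nbhs_eucl_distP x (A : set 'rV[R]_m) :
  nbhs x A <-> exists2 e, 0 < e & forall y, eucl_dist x y < e -> A y.
Proof.
split=> [/nbhs_ballP[e /= e0 eA]|[e e0 eA]].
  exists e => // y xy; apply: eA; rewrite -ball_normE/=.
  exact: le_lt_trans (ler_norm_eucl_dist _ _) xy.
(* Dividing by [m.+1] instead of [m] keeps the radius positive for every [m]. *)
apply/nbhs_ballP; exists (e / m.+1%:R) => /=; first by rewrite divr_gt0.
move=> y; rewrite -ball_normE/= => xy; apply: eA.
apply: le_lt_trans (ler_eucl_dist_norm _ _) _.
rewrite ltr_pdivlMr// mulrC in xy; apply: le_lt_trans xy.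
by rewrite ler_wpM2r// ler_nat.
Qed.

Lemma closed_eucl_distP (A : set 'rV[R]_m) :
  closed A <-> forall x,
    (forall e, 0 < e -> exists2 y, A y & eucl_dist x y < e) -> A x.
Proof.
split=> [cA x xA|cA x clx].
  apply: cA => B /nbhs_eucl_distP[e e0 eB].
  by have [y Ay xy] := xA _ e0; exists y; split => //; exact: eB.
apply: cA => e e0.
have [|y [Ay xy]] := clx [set y | eucl_dist x y < e]; last by exists y.
by apply/nbhs_eucl_distP; exists e.
Qed.

Lemma compact_eucl_ball x (r : R) : compact [set y | eucl_dist x y <= r].
Proof.
apply: bounded_closed_compact.
  exists (`|x| + r); split; first exact: num_real.
  move=> s rs y /= xy; apply: le_trans (ltW rs).
  rewrite -[X in `|X|](subrK x) addrC (le_trans (ler_normD _ _))// lerD2l.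
  by rewrite distrC (le_trans (ler_norm_eucl_dist _ _)).
apply/closed_eucl_distP => z zA; apply/ler_addgt0Pr => e e0.
have [y /= xy zy] := zA _ e0.
by rewrite (le_trans (eucl_dist_triangle y _ _))// lerD// eucl_distC ltW.
Qed.

End euclidean_distance.

(** * Hausdorff distance *)

Lemma ereal_inf_le_EFinP (R : realType) (S : set (\bar R)) (r : R) :
  (ereal_inf S <= r%:E)%E <->
  forall s, r < s -> exists2 x, S x & (x < s%:E)%E.
Proof.
split=> [Sr s rs|Sr]; first by apply: ereal_inf_lt; apply: le_lt_trans Sr _.
apply/lee_addgt0Pr => e e0.
have [|x Sx xr] := Sr (r + e); first by rewrite ltrDl.
by apply: ge_ereal_inf; exists x => //; rewrite -EFinD ltW.
Qed.

Lemma half_exp_lt (R : realType) (c e : R) : 0 < e ->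
  exists N, forall n, (N <= n)%N -> c / 2 ^+ n < e.
Proof.
move=> e0; exists (Num.bound (`|c| / e)) => n Nn.
rewrite ltr_pdivrMr ?exprn_gt0// mulrC -ltr_pdivrMr//.
apply: (@le_lt_trans _ _ (`|c| / e)).
  by rewrite ler_wpM2r ?invr_ge0 ?ler_norm// ltW.
apply: lt_le_trans (archi_boundP _) _; first by rewrite divr_ge0// ltW.
by rewrite -natrX ler_nat (leq_trans Nn)// ltnW// ltn_expl.
Qed.

Section hausdorff_distance.
Context {R : realType} {m : nat}.
Implicit Types (A B C : set 'rV[R]_m) (r s : R).

(** The one-sided half of the Hausdorff distance. The slack [s] is there because the infimum over
    [B] need not be attained. *)
Definition excess_le A B r := forall a, A a -> forall s, r < s ->
  exists2 b, B b & eucl_dist a b < s.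

Lemma excess_le_refl A : excess_le A A 0.
Proof. by move=> a Aa s s0; exists a => //; rewrite eucl_distxx. Qed.

Lemma excess_le_trans B A C r s :
  excess_le A B r -> excess_le B C s -> excess_le A C (r + s).
Proof.
move=> AB BC a Aa t rst.
(* The slack [t - r - s] is shared equally between the two steps. *)
have [|b Bb ab] := AB a Aa ((t + r - s) / 2); first by lra.
have [|c Cc bc] := BC b Bb ((t - r + s) / 2); first by lra.
by exists c => //; apply: le_lt_trans (eucl_dist_triangle b _ _) _; lra.
Qed.

Lemma hausdorff_distP A B r : (hausdorff_dist A B <= r%:E)%E <->
  excess_le A B r /\ excess_le B A r.
Proof.
rewrite /hausdorff_dist ge_max; split=> [/andP[AB BA]|[AB BA]].
  split=> [a Aa|b Bb] s rs.
    have /ereal_inf_le_EFinP/(_ s rs)[_ [b Bb <-]] :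
        (ereal_inf [set (eucl_dist a b)%:E | b in B] <= r%:E)%E.
      by apply: le_trans AB; apply: ereal_sup_ubound; exists a.
    by exists b.
  have /ereal_inf_le_EFinP/(_ s rs)[_ [a Aa <-]] :
      (ereal_inf [set (eucl_dist a b)%:E | a in A] <= r%:E)%E.
    by apply: le_trans BA; apply: ereal_sup_ubound; exists b.
  by exists a => //; rewrite eucl_distC.
apply/andP; split; apply: ge_ereal_sup => _ [c Ec <-];
    apply/ereal_inf_le_EFinP => s rs.
  by have [b Bb ?] := AB c Ec s rs; exists (eucl_dist c b)%:E => //; exists b.
have [a Aa ?] := BA c Ec s rs.
by exists (eucl_dist c a)%:E => //; exists a; rewrite // eucl_distC.
Qed.

Lemma hausdorff_distC A B : hausdorff_dist A B = hausdorff_dist B A.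
Proof.
rewrite /hausdorff_dist maxC; congr maxe; congr ereal_sup;
  apply: eq_imagel => a _; congr ereal_inf; apply: eq_imagel => b _;
  by rewrite eucl_distC.
Qed.

Lemma hausdorff_dist_ge0 A B : A !=set0 -> (0 <= hausdorff_dist A B)%E.
Proof.
move=> [a Aa]; rewrite /hausdorff_dist le_max; apply/orP; left.
apply: le_ereal_sup_tmp.
exists (ereal_inf [set (eucl_dist a b)%:E | b in B]); first by exists a.
by apply: le_ereal_inf_tmp => _ [b _ <-]; rewrite lee_fin eucl_dist_ge0.
Qed.

Lemma hausdorff_distxx A : A !=set0 -> hausdorff_dist A A = 0%E.
Proof.
move=> A0; apply/eqP; rewrite eq_le hausdorff_dist_ge0// andbT.
by apply/hausdorff_distP; split; exact: excess_le_refl.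
Qed.

(** Finite values reduce to [excess_le_trans]. Nonemptiness makes both summands nonnegative, so an
    infinite one makes the right-hand side infinite. *)
Lemma hausdorff_dist_triangle B A C : A !=set0 -> B !=set0 ->
  (hausdorff_dist A C <= hausdorff_dist A B + hausdorff_dist B C)%E.
Proof.
move=> A0 B0.
have AB0 := hausdorff_dist_ge0 _ B A0; have BC0 := hausdorff_dist_ge0 _ C B0.
move: (hausdorff_distP A B) (hausdorff_distP B C) AB0 BC0.
case: (hausdorff_dist A B) (hausdorff_dist B C) => [r| |] [s| |]//.
- move=> + + _ _.
  move=> /(_ r)[/(_ (lexx _))[AB BA] _] /(_ s)[/(_ (lexx _))[BC CB] _].
  apply/hausdorff_distP; split; first exact: excess_le_trans AB BC.
  by rewrite addrC; exact: excess_le_trans CB BA.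
- by move=> *; exact: leey.
- by move=> *; exact: leey.
- by move=> *; exact: leey.
Qed.

Lemma hausdorff_dist_eq0 A B : closed A -> closed B ->
  (hausdorff_dist A B <= 0)%E -> A = B.
Proof.
move=> /closed_eucl_distP cA /closed_eucl_distP cB.
move=> /hausdorff_distP[AB BA]; apply/seteqP; split=> x.
- by move=> Ax; apply: cB => e e0; exact: AB.
- by move=> Bx; apply: cA => e e0; exact: BA.
Qed.

Lemma hausdorff_dist_set1P A (x : 'rV[R]_m) r : A !=set0 ->
  (hausdorff_dist A [set x] <= r%:E)%E <-> A `<=` [set a | eucl_dist a x <= r].
Proof.
move=> [a0 Aa0]; rewrite hausdorff_distP; split=> [[Ax _] a Aa /=|Ax].
  apply/ler_addgt0Pr => e e0.
  have [|b /= -> ab] := Ax a Aa (r + e); first by rewrite ltrDl.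
  exact: ltW.
split=> [a Aa s rs|_ -> s rs].
  by exists x => //; exact: le_lt_trans (Ax a Aa) rs.
by exists a0 => //; rewrite eucl_distC; exact: le_lt_trans (Ax _ Aa0) rs.
Qed.

(* The lower limit in the sense of Kuratowski. *)
Definition set_liminf (A : nat -> set 'rV[R]_m) : set 'rV[R]_m :=
  [set x | forall e, 0 < e -> exists N, forall n, (N <= n)%N ->
     exists2 y, A n y & eucl_dist x y < e].

(** * Geometrically converging sequences of sets *)

Section geometric_sequence.
Variables (A : nat -> set 'rV[R]_m) (c : R).
Hypothesis c0 : 0 <= c.
Hypothesis Ac : forall k, (hausdorff_dist (A k) (A k.+1) <= (c / 2 ^+ k)%:E)%E.

Lemma geometric_set_liminf_sub n :
  excess_le (set_liminf A) (A n) (c *+ 2 / 2 ^+ n).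
Proof.
(* The bound is the partial geometric sum of [c / 2 ^+ k] for [k] from [n] to [n + i - 1]. *)
have An i : excess_le (A (n + i)%N) (A n)
    (c *+ 2 / 2 ^+ n - c *+ 2 / 2 ^+ (n + i)%N).
  elim: i => [|i IH]; first by rewrite addn0 subrr; exact: excess_le_refl.
  have /hausdorff_distP[_ H] := Ac (n + i); rewrite addnS.
  suff -> : c *+ 2 / 2 ^+ n - c *+ 2 / 2 ^+ (n + i).+1 =
    c / 2 ^+ (n + i) + (c *+ 2 / 2 ^+ n - c *+ 2 / 2 ^+ (n + i)) :> R.
    exact: excess_le_trans H IH.
  rewrite exprS invfM; set t := (2 ^+ (n + i))^-1; set z := _ / 2 ^+ n.
  by field.
move=> x Lx s cs; set r := c *+ 2 / 2 ^+ n in cs *.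
(* Half of the slack [s - r] is spent on going from [x] to [A (n + N)], the other half on the way
   back to [A n]. *)
have [|N NP] := Lx ((s - r) / 2); first by lra.
have [|y Ay xy] := NP (n + N)%N; first exact: leq_addl.
have [|z Az yz] := An N y Ay ((s + r) / 2).
  have : 0 <= c *+ 2 / 2 ^+ (n + N) by rewrite divr_ge0// mulrn_wge0.
  by rewrite -/r; lra.
by exists z => //; apply: le_lt_trans (eucl_dist_triangle y _ _) _; lra.
Qed.

(** A chain of points [b j] in [A (n + j)] starts at [a] with steps below [e / 2 ^+ (n + j)]; it is
    Cauchy and its limit lies in the lower limit. Taking [e] above [c] leaves room for infima that
    are not attained. *)
Lemma geometric_set_liminf_approx (e : R) n a : c < e -> A n a ->
  exists2 x, set_liminf A x & eucl_dist a x <= e *+ 2 / 2 ^+ n.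
Proof.
move=> ce Aa.
(* Off [A k] the value [x] is a dummy that makes the successor function total. *)
have /choice[f fP] : forall kx : nat * 'rV[R]_m, exists y, A kx.1 kx.2 ->
    A kx.1.+1 y /\ eucl_dist kx.2 y < e / 2 ^+ kx.1.
  move=> [k x]; have [Akx|?] := pselect (A k x); last by exists x.
  have /hausdorff_distP[/(_ x Akx (e / 2 ^+ k))[|y]] := Ac k.
    by rewrite ltr_pM2r// invr_gt0 exprn_gt0.
  by exists y.
have [b [b0 bS]] : exists b, b 0%N = a /\ forall j, b j.+1 = f ((n + j)%N, b j).
  by exists (fix b j := if j is j'.+1 then f ((n + j')%N, b j') else a).
have Ab j : A (n + j)%N (b j).
  elim: j => [|j IH]; first by rewrite addn0 b0.
  by rewrite addnS bS; have [] := fP ((n + j)%N, b j) IH.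
have bb i j : eucl_dist (b j) (b (j + i)%N) <=
    e *+ 2 / 2 ^+ (n + j) - e *+ 2 / 2 ^+ (n + j + i).
  elim: i => [|i IH]; first by rewrite !addn0 eucl_distxx subrr.
  rewrite [(j + i.+1)%N]addnS.
  apply: le_trans (eucl_dist_triangle (b (j + i)%N) _ _) _.
  have [_ /= /ltW] := fP ((n + (j + i))%N, b (j + i)%N) (Ab _).
  rewrite -bS => H.
  apply: le_trans (lerD IH H) _.
  rewrite !addnS exprS invfM addnA; set t := (2 ^+ (n + j + i))^-1.
  rewrite -subr_ge0; set z := _ / 2 ^+ (n + j).
  by rewrite (_ : _ - _ = 0); last by field.
have e0 : 0 < e by exact: le_lt_trans ce.
have bb' i j : (j <= i)%N -> eucl_dist (b j) (b i) <= e *+ 2 / 2 ^+ (n + j).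
  move=> ji; rewrite -(subnKC ji); apply: le_trans (bb _ _) _.
  by rewrite gerBl divr_ge0// mulrn_wge0// ltW.
have small d : 0 < d -> exists N, forall j, (N <= j)%N ->
    e *+ 2 / 2 ^+ (n + j) < d.
  move=> d0; have [N NP] := half_exp_lt R (e *+ 2) d d0.
  by exists N => j Nj; apply: NP; rewrite (leq_trans Nj)// leq_addl.
have /cauchy_cvgP : cauchy (b @ \oo).
  apply: cauchy_exP => d d0; have [N NP] := small d d0.
  exists (b N); exists N => // i /= Ni; rewrite -ball_normE/=.
  apply: le_lt_trans (ler_norm_eucl_dist _ _) _.
  apply: (@le_lt_trans _ _ (e *+ 2 / 2 ^+ (n + N))); last exact: NP.
  exact: bb'.
move=> /cvg_ex[x bx].
have bxle j : eucl_dist (b j) x <= e *+ 2 / 2 ^+ (n + j).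
  apply/ler_addgt0Pr => d d0.
  have : nbhs x [set y | eucl_dist x y < d].
    by apply/nbhs_eucl_distP; exists d.
  move=> /bx[N _ NP]; have := NP (maxn N j) (leq_maxl _ _) => /= xd.
  apply: le_trans (eucl_dist_triangle (b (maxn N j)) _ _) _.
  by rewrite lerD ?bb' ?leq_maxr// eucl_distC ltW.
exists x; last by have := bxle 0%N; rewrite addn0 b0.
move=> d d0; have [N NP] := small d d0; exists (n + N)%N => k nNk.
have nk : (n <= k)%N by rewrite (leq_trans _ nNk)// leq_addr.
exists (b (k - n)%N); first by have := Ab (k - n)%N; rewrite subnKC.
rewrite eucl_distC; apply: le_lt_trans (bxle _) _.
by apply: NP; rewrite leq_subRL.
Qed.

Lemma geometric_set_liminf n :
  (hausdorff_dist (set_liminf A) (A n) <= (c *+ 2 / 2 ^+ n)%:E)%E.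
Proof.
apply/hausdorff_distP; split; first exact: geometric_set_liminf_sub.
move=> a Aa s cs.
(* The chosen [e] is the midpoint of [c] and [s * 2 ^+ n / 2]; it exceeds [c] and still gives
   [e *+ 2 / 2 ^+ n < s]. *)
have cd : c < (c + s * 2 ^+ n / 2) / 2.
  suff : c < s * 2 ^+ n / 2 by lra.
  by move: cs; rewrite ltr_pdivrMr ?exprn_gt0// => cs; lra.
have [x Lx ax] := geometric_set_liminf_approx _ n a cd Aa.
exists x => //; apply: le_lt_trans ax _.
by move: cs; rewrite !ltr_pdivrMr ?exprn_gt0// => cs; lra.
Qed.

End geometric_sequence.
End hausdorff_distance.

(** * Measurability of the distance between cuts *)

Section left_lower_semicontinuity.
Context {R : realType}.

(** Only the left side is controlled: cuts of an upper semi-continuous function may jump when the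
    level increases past [a]. *)
Definition left_lsc (f : R -> \bar R) := forall a c, 0 < a <= 1 ->
  (c%:E < f a)%E ->
  exists2 b, b < a & forall g, 0 < g -> b < g <= a -> (c%:E < f g)%E.

(* A superlevel set of [f] is a countable union of the intervals formed, for a
   rational [q], by the points that can be reached from [q] inside it. *)
Lemma left_lsc_measurable (f : R -> \bar R) : left_lsc f ->
  measurable_fun (`]0, 1] : set R) f.
Proof.
move=> flsc; apply: (measurability _ (ErealGenOInfty.measurableE R)).
move=> /= _ [_ [c ->]] <-; rewrite preimage_itvoy.
pose I (q : rat) := [set a | [/\ 0 < a <= 1, ratr q <= a &
  forall g, 0 < g -> ratr q <= g <= a -> (c%:E < f g)%E]].
rewrite (_ : _ `&` _ = \bigcup_q I q).
  apply: bigcupT_measurable_rat => q; apply: is_interval_measurable.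
  move=> x y [/andP[x0 _] qx _] [/andP[_ y1] qy Iy] z /andP[xz zy]; split.
  - by rewrite (lt_le_trans x0 xz) (le_trans zy y1).
  - exact: le_trans xz.
  - move=> g g0 /andP[qg gz]; apply: Iy => //.
    by rewrite qg (le_trans gz zy).
apply/seteqP; split=> [a [/=]|a [q _ [/andP[a0 a1] qa Iq]]].
  rewrite in_itv/= => /[dup] a01 /andP[a0 a1] cfa.
  have [b ba bP] := flsc a c a01 cfa.
  have [|q] := @rat_in_itvoo R (Num.max b 0) a; first by rewrite gt_max ba.
  rewrite in_itv/= gt_max => /andP[/andP[bq q0] qa].
  exists q => //; split => //; first exact: ltW.
  move=> g g0 /andP[qg ga]; apply: bP => //.
  by rewrite (lt_le_trans bq qg).
split=> /=; first by rewrite in_itv/= a0.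
by apply: Iq => //; rewrite qa lexx.
Qed.

End left_lower_semicontinuity.

(** * Cuts of upper semi-continuous functions *)

Section cuts.
Context {R : realType} {m : nat}.
Implicit Types u v : 'rV[R]_m -> R.

Lemma fuzzy_cutE u (a : R) : 0 < a -> fuzzy_cut u a = [set x | a <= u x].
Proof. by move=> a0; rewrite /fuzzy_cut gt_eqF. Qed.

Lemma upper_semicontinuousP u : upper_semicontinuous u <->
  forall x c, u x < c ->
    exists2 e, 0 < e & forall y, eucl_dist x y < e -> u y < c.
Proof.
split=> [uscu x c uxc|uscu x c].
  have [|V /nbhs_eucl_distP[e e0 eV] Vu] := uscu x (- c).
    by rewrite lte_fin ltrN2.
  by exists e => // y /eV/Vu; rewrite lte_fin ltrN2.
rewrite lte_fin ltrNr => /uscu[e e0 eu].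
exists [set y | eucl_dist x y < e]; first by apply/nbhs_eucl_distP; exists e.
by move=> y /eu; rewrite lte_fin ltrNr.
Qed.

Lemma closed_fuzzy_cut u (a : R) : upper_semicontinuous u ->
  closed (fuzzy_cut u a).
Proof.
move=> /upper_semicontinuousP uscu; rewrite /fuzzy_cut; case: ifPn => _.
  exact: closed_closure.
apply/closed_eucl_distP => x xa /=; rewrite leNgt; apply/negP => /uscu[e e0 eu].
by have [y /= ay /eu] := xa e e0; rewrite ltNge ay.
Qed.

(** Compactness of the ball makes the strict bound uniform: near each point some bound below [a]
    works, and finitely many of them suffice. The covering argument is run with the filter of left
    neighbourhoods of [a]. *)
Lemma upper_semicontinuous_ball_lt u x (r a : R) : upper_semicontinuous u ->
  (forall y, eucl_dist x y <= r -> u y < a) ->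
  exists2 b, b < a & forall y, eucl_dist x y <= r -> u y < b.
Proof.
move=> /upper_semicontinuousP uscu ua.
have H : \forall b \near a^'-, [set y | eucl_dist x y <= r] `<=`
    (fun y => u y < b).
  have /compact_near_coveringP/(_ R a^'- (fun b y => u y < b)) :=
    compact_eucl_ball x r.
  apply=> y /= /ua uya.
  have [|e e0 eu] := uscu y ((u y + a) / 2); first by lra.
  exists ([set z | eucl_dist y z < e], [set b | (u y + a) / 2 < b]) => /=.
    split; first by apply/nbhs_eucl_distP; exists e.
    by apply: nbhs_left_gt; lra.
  by move=> [z b] /= [/eu uz]; exact: lt_trans.
have [b [bu ba]] := filter_ex (filterI H (nbhs_left_lt a)).
by exists b.
Qed.

(** A point [x] of [[u]_a] too far from [[v]_a] has a ball on which [v < a], hence [v < b] for some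
    [b < a]. For [g] in []b, a]] this ball misses [[v]_g], while [x] still belongs to [[u]_g]. *)
Lemma excess_fuzzy_cut_left u v (a c : R) : upper_semicontinuous v ->
  0 < a -> ~ excess_le (fuzzy_cut u a) (fuzzy_cut v a) c ->
  exists2 b, b < a & forall g, 0 < g -> b < g <= a ->
    ~ excess_le (fuzzy_cut u g) (fuzzy_cut v g) c.
Proof.
move=> uscv a0; rewrite !fuzzy_cutE//.
move=> /existsNP[x /not_implyP[/= ax /existsNP[s /not_implyP[cs nx]]]].
(* The radius lies strictly between [c] and [s]: the closed ball avoids [[v]_a] and still witnesses
   an excess above [c]. *)
have [|b ba bv] := upper_semicontinuous_ball_lt v x ((c + s) / 2) a uscv.
  move=> y xy; rewrite ltNge; apply/negP => ay; apply: nx; exists y => //.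
  by apply: le_lt_trans xy _; lra.
exists b => // g g0 /andP[bg ga]; rewrite !fuzzy_cutE// => guv.
have [||y /= gy /ltW/bv] := guv x _ ((c + s) / 2).
- exact: le_trans ax.
- by lra.
by rewrite ltNge (le_trans (ltW bg) gy).
Qed.

Lemma left_lsc_hausdorff_dist u v :
  upper_semicontinuous u -> upper_semicontinuous v ->
  left_lsc (fun a => hausdorff_dist (fuzzy_cut u a) (fuzzy_cut v a)).
Proof.
move=> uscu uscv a c /andP[a0 a1]; rewrite ltNge => /negP.
move=> /hausdorff_distP/not_andP[].
- move=> /(excess_fuzzy_cut_left u v a c uscv a0)[b ba bP].
  exists b => // g g0 bga; rewrite ltNge; apply/negP => /hausdorff_distP[uv _].
  exact: bP uv.
- move=> /(excess_fuzzy_cut_left v u a c uscu a0)[b ba bP].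
  exists b => // g g0 bga; rewrite ltNge; apply/negP => /hausdorff_distP[_ vu].
  exact: bP vu.
Qed.

Lemma measurable_hausdorff_dist u v :
  upper_semicontinuous u -> upper_semicontinuous v ->
  measurable_fun (`]0, 1] : set R)
    (fun a => hausdorff_dist (fuzzy_cut u a) (fuzzy_cut v a)).
Proof.
move=> uscu uscv; apply: left_lsc_measurable.
exact: left_lsc_hausdorff_dist.
Qed.

End cuts.

(** * The triangle inequality in Lp *)

Section Lp_triangle.
Context d (T : measurableType d) (R : realType).
Variables (mu : {measure set T -> \bar R}) (p : R).
Hypothesis p1 : 1 <= p.
Local Open Scope ereal_scope.
Implicit Types (f g h : T -> \bar R) (D : set T).

Let p0 : (0 < p)%R. Proof. exact: lt_le_trans p1. Qed.
Let p_neq0 : p != 0%R. Proof. by rewrite gt_eqF. Qed.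

Lemma le_poweR (x y : \bar R) (r : R) : (0 <= r)%R -> 0 <= x -> x <= y ->
  x `^ r <= y `^ r.
Proof.
move=> r0 x0 xy; apply: gt0_ler_poweR => //; rewrite in_itv/= leey andbT//.
exact: le_trans xy.
Qed.

Lemma measurable_fun_poweR D f (r : R) :
  measurable_fun D f -> measurable_fun D (fun x => f x `^ r).
Proof. by move=> mf; exact: (measurableT_comp (measurable_poweR r)). Qed.

Lemma poweR_integral_ae_fin_num D f : measurable D -> measurable_fun D f ->
  (forall x, D x -> 0 <= f x) -> \int[mu]_(x in D) f x `^ p < +oo ->
  {ae mu, forall x, D x -> f x \is a fin_num}.
Proof.
move=> mD mf f0 foo.
have : mu.-integrable D (fun x => f x `^ p).
  apply/integrableP; split; first exact: measurable_fun_poweR.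
  by under eq_integral do rewrite gee0_abs ?poweR_ge0//.
move=> /(integrable_ae mD); apply: filterS => x /= fx Dx.
rewrite ge0_fin_numE ?f0// (@lty_poweRy _ _ p)//.
by rewrite -ge0_fin_numE ?poweR_ge0// fx.
Qed.

(** Passes from extended-valued functions to real ones, for which Minkowski's inequality is stated;
    a finite integral makes [f] finite almost everywhere. *)
Lemma Lnorm_fine f : measurable_fun setT f -> (forall x, 0 <= f x) ->
  \int[mu]_x f x `^ p < +oo ->
  Lnorm mu p%:E (EFin \o (fine \o f)) = (\int[mu]_x f x `^ p) `^ p^-1.
Proof.
move=> mf f0 foo; rewrite unlock; congr (_ `^ _).
apply: ge0_ae_eq_integral => //.
- apply: measurable_fun_poweR; apply: measurableT_comp => //.
  by apply/measurable_EFinP; exact: (measurableT_comp (fine_measurable _)).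
- exact: measurable_fun_poweR.
- by move=> x _; exact: poweR_ge0.
- by move=> x _; exact: poweR_ge0.
have := poweR_integral_ae_fin_num _ _ measurableT mf (fun x _ => f0 x) foo.
apply: filterS => x /= fx _.
by rewrite -[in RHS](fineK (fx I)) poweR_EFin ger0_norm ?fine_ge0.
Qed.

(** An infinite integral on the right is trivial. Otherwise [f] and [g] are finite almost
    everywhere, so Minkowski applies to their real parts, whose sum dominates [h] almost
    everywhere. *)
Lemma Lp_triangle_setT f g h : measurable_fun setT f -> measurable_fun setT g ->
  measurable_fun setT h -> (forall x, 0 <= f x) -> (forall x, 0 <= g x) ->
  (forall x, 0 <= h x) -> (forall x, h x <= f x + g x) ->
  (\int[mu]_x h x `^ p) `^ p^-1 <=
  (\int[mu]_x f x `^ p) `^ p^-1 + (\int[mu]_x g x `^ p) `^ p^-1.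
Proof.
move=> mf mg mh f0 g0 h0 hfg.
have [->|] := eqVneq (\int[mu]_x f x `^ p) +oo.
  rewrite poweRyr ?invr_eq0// addye ?leey// -ltNye.
  by rewrite (lt_le_trans _ (poweR_ge0 _ _)).
rewrite -ltey => foo.
have [->|] := eqVneq (\int[mu]_x g x `^ p) +oo.
  rewrite poweRyr ?invr_eq0// addey ?leey// -ltNye.
  by rewrite (lt_le_trans _ (poweR_ge0 _ _)).
rewrite -ltey => goo.
rewrite -(Lnorm_fine f)// -(Lnorm_fine g)//.
have mf' : measurable_fun setT (fine \o f).
  exact: (measurableT_comp (fine_measurable _)).
have mg' : measurable_fun setT (fine \o g).
  exact: (measurableT_comp (fine_measurable _)).
apply: le_trans (minkowski_EFin _ mf' mg' p1).
rewrite unlock; apply: le_poweR; first by rewrite invr_ge0 ltW.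
  by apply: integral_ge0 => x _; exact: poweR_ge0.
apply: ae_ge0_le_integral => //.
- by move=> x _; exact: poweR_ge0.
- exact: measurable_fun_poweR.
- by move=> x _; exact: poweR_ge0.
- apply: measurable_fun_poweR; apply: measurableT_comp => //.
  by apply/measurable_EFinP; exact: measurable_funD.
have := poweR_integral_ae_fin_num _ _ measurableT mf (fun x _ => f0 x) foo.
have := poweR_integral_ae_fin_num _ _ measurableT mg (fun x _ => g0 x) goo.
apply: filterS2 => x /(_ I) gx /(_ I) fx _.
rewrite [leRHS](_ : _ = (f x + g x) `^ p).
  by apply: le_poweR => //; exact: ltW.
rewrite -[in RHS](fineK fx) -[in RHS](fineK gx) -EFinD poweR_EFin/=.
by rewrite ger0_norm// addr_ge0// fine_ge0.
Qed.

Lemma Lp_triangle D f g h : measurable D -> measurable_fun D f ->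
  measurable_fun D g -> measurable_fun D h ->
  (forall x, D x -> 0 <= f x) -> (forall x, D x -> 0 <= g x) ->
  (forall x, D x -> 0 <= h x) -> (forall x, D x -> h x <= f x + g x) ->
  (\int[mu]_(x in D) h x `^ p) `^ p^-1 <=
  (\int[mu]_(x in D) f x `^ p) `^ p^-1 + (\int[mu]_(x in D) g x `^ p) `^ p^-1.
Proof.
move=> mD mf mg mh f0 g0 h0 hfg.
(* Extension by zero is compatible with the power because [p] is nonzero. *)
have E k : \int[mu]_(x in D) k x `^ p = \int[mu]_x (k \_ D) x `^ p.
  rewrite integral_mkcond; apply: eq_integral => x _; rewrite !patchE.
  by case: ifPn; rewrite ?poweR0r.
rewrite !E; apply: Lp_triangle_setT; try by apply/(measurable_restrictT _ mD).
all: by move=> x; rewrite !patchE; case: ifPn => [/set_mem Dx|_]; auto;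
  rewrite ?adde0.
Qed.

End Lp_triangle.

(** * Sets of full measure in the unit interval *)

Section unit_interval.
Context {R : realType}.
Local Notation mu := (@lebesgue_measure R).

(** Otherwise the interval []max b 0, a]], which has positive length, would lie in a null set. *)
Lemma ae_dense01 (P : R -> Prop) (a b : R) :
  {ae mu, forall x, 0 < x <= 1 -> P x} -> 0 < a <= 1 -> b < a ->
  exists g, [/\ 0 < g, b < g <= a & P g].
Proof.
move=> [N [mN N0 PN]] /andP[a0 a1] ba; apply: contrapT => nP.
have : (mu `]Num.max b 0%R, a] <= mu N)%E.
  apply: le_measure; rewrite ?inE// => x /=.
  rewrite in_itv/= gt_max => /andP[/andP[bx x0] xa].
  apply: PN => /= Px; apply: nP; exists x; split => //; first by rewrite bx.
  by apply: Px; rewrite x0 (le_trans xa).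
rewrite [X in (_ <= X)%E -> _](_ : _ = 0%E)//.
rewrite lebesgue_measure_itv/= lte_fin gt_max ba a0/=.
by rewrite -EFinD lee_fin subr_le0 le_max !leNgt ba a0.
Qed.

End unit_interval.

(** * The metric d_p *)

Section fuzzy_star_shaped.
Context {R : realType} {m : nat}.
Implicit Types u v w : 'rV[R]_m -> R.

Definition star_fuzzy u :=
  [/\ fuzzy_set u, normal_fuzzy u, upper_semicontinuous u & star_shaped0 u].

Lemma star_fuzzy_usc u : star_fuzzy u -> upper_semicontinuous u.
Proof. by case. Qed.

Lemma star_fuzzy0 u : star_fuzzy u -> u 0 = 1.
Proof.
move=> [u01 [x0 ux0] _ su]; apply/eqP; rewrite eq_le; apply/andP; split.
  by have /andP[] := u01 0.
by rewrite -ux0 -(scale0r x0) su// lexx ler01.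
Qed.

Lemma fuzzy_cut_neq0 u (a : R) : star_fuzzy u -> 0 < a <= 1 ->
  fuzzy_cut u a !=set0.
Proof.
move=> su /andP[a0 a1]; exists 0.
by rewrite fuzzy_cutE//= star_fuzzy0.
Qed.

(** With this base point, the integrability condition of [S0mp] becomes finiteness of a [fuzzy_dp]
    distance. *)
Definition fuzzy_origin (x : 'rV[R]_m) : R := (x == 0)%:R.

Lemma fuzzy_cut_origin (a : R) : 0 < a <= 1 ->
  fuzzy_cut fuzzy_origin a = [set 0].
Proof.
move=> /andP[a0 a1]; rewrite fuzzy_cutE// /fuzzy_origin.
apply/seteqP; split=> [x /=|_ /= ->]; last by rewrite eqxx.
by have [->//|_] := eqVneq x 0; rewrite leNgt a0.
Qed.

Lemma star_fuzzy_origin : star_fuzzy fuzzy_origin.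
Proof.
split.
- by move=> x; rewrite /fuzzy_origin; case: eqP; rewrite ?lexx ler01.
- by exists 0; rewrite /fuzzy_origin eqxx.
- apply/upper_semicontinuousP => x c; rewrite /fuzzy_origin.
  have [-> c1|x0 c0] := eqVneq x 0.
    by exists 1 => // y _; apply: le_lt_trans c1; case: eqP.
  have xd : 0 < eucl_dist x 0.
    rewrite lt_def eucl_dist_ge0 andbT; apply: contra_neq x0.
    exact: eucl_dist_eq0.
  exists (eucl_dist x 0) => // y; case: eqP => [->|//].
  by rewrite ltxx.
- move=> y l _; rewrite /fuzzy_origin; have [->|//] := eqVneq y 0.
  by rewrite scaler0 eqxx.
Qed.

Definition cut_dist u v (a : R) : \bar R :=
  hausdorff_dist (fuzzy_cut u a) (fuzzy_cut v a).

Lemma cut_dist_ge0 u v (a : R) : star_fuzzy u -> 0 < a <= 1 ->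
  (0 <= cut_dist u v a)%E.
Proof. by move=> su a01; apply/hausdorff_dist_ge0/fuzzy_cut_neq0. Qed.

Lemma measurable_cut_dist u v : star_fuzzy u -> star_fuzzy v ->
  measurable_fun (`]0, 1] : set R) (cut_dist u v).
Proof.
by move=> /star_fuzzy_usc ? /star_fuzzy_usc ?; exact: measurable_hausdorff_dist.
Qed.

Section dp.
Variable p : R.
Hypothesis p1 : 1 <= p.
Local Notation mu := (@lebesgue_measure R).

Let p0 : 0 < p. Proof. exact: lt_le_trans p1. Qed.

Lemma fuzzy_dpE u v : star_fuzzy u -> star_fuzzy v -> fuzzy_dp p u v =
  poweR (\int[mu]_(a in `]0%R, 1%R]) poweR (cut_dist u v a) p)%E p^-1.
Proof.
move=> su sv; rewrite /fuzzy_dp /Lp_hausdorff_dist integral_itv_obnd_cbnd//.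
by apply: measurable_fun_poweR; exact: measurable_cut_dist.
Qed.

Lemma Lp_hausdorff_dist_origin u : star_fuzzy u ->
  Lp_hausdorff_dist p (fuzzy_cut u) (fun=> [set 0]) =
  fuzzy_dp p u fuzzy_origin.
Proof.
move=> su; rewrite (fuzzy_dpE _ _ su star_fuzzy_origin) /Lp_hausdorff_dist.
have E a : 0 < a <= 1 -> hausdorff_dist (fuzzy_cut u a) [set 0] =
    cut_dist u fuzzy_origin a.
  by move=> a01; rewrite /cut_dist fuzzy_cut_origin.
rewrite -integral_itv_obnd_cbnd.
  apply: (congr1 (fun x => poweR x p^-1)); apply: eq_integral => a.
  by rewrite inE/= in_itv/= => a01; rewrite E.
apply: measurable_fun_poweR.
apply: eq_measurable_fun (measurable_cut_dist _ _ su star_fuzzy_origin).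
by move=> a; rewrite inE/= in_itv/= => a01; rewrite E.
Qed.

Lemma S0mpP u : S0mp p u <->
  star_fuzzy u /\ (fuzzy_dp p u fuzzy_origin < +oo)%E.
Proof.
split=> [[f n us dp s]|[su dp]].
  have su : star_fuzzy u by split.
  by split; [exact: su|rewrite -(Lp_hausdorff_dist_origin _ su)].
have [f n us s] := su.
by split; [exact: f|exact: n|exact: us| |exact: s];
  rewrite (Lp_hausdorff_dist_origin _ su).
Qed.

Lemma S0m_S0mp : S0m (R := R) (m := m) `<=` S0mp p.
Proof.
move=> u [fu nu uscu bu ssu]; have su : star_fuzzy u by split.
apply/S0mpP; split=> //; rewrite (fuzzy_dpE _ _ su star_fuzzy_origin).
have [M [_ MP]] := bu.
(* Boundedness provides a bound by every number above [M], such as [|M| + 1]; the factor [m]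
   converts the sup norm into Euclidean distance. *)
pose c := m%:R * (`|M| + 1).
have c0 : 0 <= c by rewrite mulr_ge0// addr_ge0.
apply: poweR_lty.
apply: (@le_lt_trans _ _ (\int[mu]_(a in `]0%R, 1%R]) (c `^ p)%:E)%E).
  apply: ge0_le_integral => //.
  - by move=> a _; exact: poweR_ge0.
  - apply: measurable_fun_poweR; apply: measurable_cut_dist => //.
    exact: star_fuzzy_origin.
  move=> a /=; rewrite in_itv/= => a01; rewrite -poweR_EFin; apply: le_poweR.
  - exact: ltW.
  - exact: cut_dist_ge0.
  rewrite /cut_dist fuzzy_cut_origin//; apply/hausdorff_dist_set1P.
    exact: fuzzy_cut_neq0.
  move=> x; rewrite fuzzy_cutE; last by case/andP: a01.
  move=> /= ax; apply: le_trans (ler_eucl_dist_norm _ _) _.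
  rewrite ler_wpM2l// subr0; apply: MP.
    by rewrite (le_lt_trans (ler_norm M))// ltrDl.
  rewrite /fuzzy_cut eqxx; apply: subset_closure => /=.
  by apply: lt_le_trans ax; case/andP: a01.
rewrite integral_cst//= lebesgue_measure_itv/= lte_fin ltr01.
by rewrite -EFinD -EFinM ltry.
Qed.

Lemma fuzzy_dp_ge0 u v : (0 <= fuzzy_dp p u v)%E.
Proof. exact: poweR_ge0. Qed.

Lemma fuzzy_dpC u v : fuzzy_dp p u v = fuzzy_dp p v u.
Proof.
rewrite /fuzzy_dp /Lp_hausdorff_dist; apply: (congr1 (fun x => poweR x p^-1)).
by apply: eq_integral => a _; rewrite hausdorff_distC.
Qed.

Lemma fuzzy_dp_triangle v u w : star_fuzzy u -> star_fuzzy v -> star_fuzzy w ->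
  (fuzzy_dp p u w <= fuzzy_dp p u v + fuzzy_dp p v w)%E.
Proof.
move=> su sv sw.
rewrite (fuzzy_dpE _ _ su sv) (fuzzy_dpE _ _ sv sw) (fuzzy_dpE _ _ su sw).
apply: Lp_triangle => //.
- exact: measurable_cut_dist.
- exact: measurable_cut_dist.
- exact: measurable_cut_dist.
- by move=> a /=; rewrite in_itv/=; exact: cut_dist_ge0.
- by move=> a /=; rewrite in_itv/=; exact: cut_dist_ge0.
- by move=> a /=; rewrite in_itv/=; exact: cut_dist_ge0.
- move=> a /=; rewrite in_itv/= => a01.
  by apply: hausdorff_dist_triangle; exact: fuzzy_cut_neq0.
Qed.

Lemma fuzzy_dpxx u : star_fuzzy u -> fuzzy_dp p u u = 0%E.
Proof.
move=> su; rewrite (fuzzy_dpE _ _ su su) integral0_eq.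
  by rewrite poweR0r// invr_eq0 gt_eqF.
move=> a /=; rewrite in_itv/= => a01.
rewrite /cut_dist hausdorff_distxx ?poweR0r ?gt_eqF//.
exact: fuzzy_cut_neq0.
Qed.

Lemma le_of_fuzzy_cut_sub u v : fuzzy_set u ->
  (forall a, 0 < a <= 1 -> fuzzy_cut u a `<=` fuzzy_cut v a) ->
  fuzzy_set v -> forall x, u x <= v x.
Proof.
move=> fu uv fv x; have /andP[u0 u1] := fu x.
have [ux0|ux0] := ltP 0 (u x); last first.
  by have /andP[v0 _] := fv x; exact: le_trans v0.
have := uv (u x); rewrite ux0 u1 !fuzzy_cutE// => /(_ isT x); apply.
exact: lexx.
Qed.

(** The cuts have distance zero at almost every level. A positive distance at one level would
    persist on an interval to its left, which meets every set of full measure; so all cuts agree,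
    and they determine the function. *)
Lemma fuzzy_dp_eq0 u v : star_fuzzy u -> star_fuzzy v ->
  fuzzy_dp p u v = 0%E -> u = v.
Proof.
move=> su sv; rewrite (fuzzy_dpE _ _ su sv) => /poweR_eq0_eq0 dp0.
have {}dp0 : (\int[mu]_(a in `]0%R, 1%R]) `|poweR (cut_dist u v a) p| = 0)%E.
  under eq_integral do rewrite gee0_abs ?poweR_ge0//.
  by apply: dp0; apply: integral_ge0 => a _; exact: poweR_ge0.
have mf : measurable_fun (`]0, 1] : set R) (fun a => poweR (cut_dist u v a) p).
  by apply: measurable_fun_poweR; exact: measurable_cut_dist.
have ae0 : {ae mu, forall a, 0 < a <= 1 -> cut_dist u v a = 0%E}.
  move: dp0 => /(ae_eq_integral_abs mu (measurable_itv _) mf).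
  apply: filterS => a + a01; rewrite /= in_itv/= => /(_ a01).
  by apply: poweR_eq0_eq0; exact: cut_dist_ge0.
have cut_eq a : 0 < a <= 1 -> fuzzy_cut u a = fuzzy_cut v a.
  move=> a01; have uscu := star_fuzzy_usc _ su.
  have uscv := star_fuzzy_usc _ sv.
  apply: hausdorff_dist_eq0; [exact: closed_fuzzy_cut..|].
  rewrite leNgt; apply/negP => uv0.
  have [b ba bP] := left_lsc_hausdorff_dist u v uscu uscv a 0 a01 uv0.
  have [g [g0 bga g_eq0]] := ae_dense01 _ a b ae0 a01 ba.
  by have := bP g g0 bga; rewrite -/(cut_dist u v g) g_eq0 ltxx.
have [fu _ _ _] := su; have [fv _ _ _] := sv.
apply/funext => x; apply/eqP; rewrite eq_le.
by rewrite !le_of_fuzzy_cut_sub// => a a01; rewrite cut_eq.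
Qed.

Lemma fuzzy_dp_metric_on : metric_on (S0mp (m := m) p) (fuzzy_dp p).
Proof.
split.
- move=> u v /S0mpP[su u0] /S0mpP[sv v0]; rewrite fuzzy_dp_ge0/=.
  apply: le_lt_trans (fuzzy_dp_triangle _ _ _ su star_fuzzy_origin sv) _.
  by apply: lte_add_pinfty; [exact: u0|rewrite fuzzy_dpC; exact: v0].
- move=> u v /S0mpP[su u0] /S0mpP[sv v0]; split; first exact: fuzzy_dp_eq0.
  by move=> ->; exact: fuzzy_dpxx.
- by move=> u v _ _; exact: fuzzy_dpC.
- move=> u v w /S0mpP[su _] /S0mpP[sv _] /S0mpP[sw _].
  exact: fuzzy_dp_triangle.
Qed.

End dp.
End fuzzy_star_shaped.

(** * Density *)

Section truncation.
Context {R : realType} {m : nat}.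
Implicit Types u v w : 'rV[R]_m -> R.
Local Notation mu := (@lebesgue_measure R).

Definition fuzzy_trunc (t : R) u (x : 'rV[R]_m) : R :=
  if t <= u x then u x else 0.

Lemma star_fuzzy_trunc (t : R) u : 0 < t <= 1 -> star_fuzzy u ->
  star_fuzzy (fuzzy_trunc t u).
Proof.
move=> /andP[t0 t1] su; have [fu _ uscu ssu] := su; split.
- by move=> x; rewrite /fuzzy_trunc; case: ifP; rewrite ?lexx ?ler01// fu.
- by exists 0; rewrite /fuzzy_trunc star_fuzzy0// t1.
- move/upper_semicontinuousP in uscu; apply/upper_semicontinuousP => x c.
  rewrite /fuzzy_trunc; case: ifPn => [tux /uscu[e e0 eu]|].
    exists e => // y xy; case: ifPn => _; first exact: eu.
    by have /andP[u0 _] := fu y; exact: le_lt_trans u0 (eu y xy).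
  rewrite -ltNge => /uscu[e e0 eu] c0; exists e => // y /eu.
  by rewrite ltNge => /negbTE ->.
- move=> y l l01; have uyl := ssu y l l01; rewrite /fuzzy_trunc.
  case: ifPn => [tuy|_]; first by rewrite (le_trans tuy uyl).
  by case: ifPn => _ //; have /andP[] := fu (l *: y).
Qed.

Lemma fuzzy_cut_trunc_sub (t a : R) u : 0 < a ->
  fuzzy_cut (fuzzy_trunc t u) a `<=` fuzzy_cut u a.
Proof.
move=> a0 x; rewrite !fuzzy_cutE// /= /fuzzy_trunc; case: ifP => // _.
by rewrite leNgt a0.
Qed.

Lemma fuzzy_cut_trunc (t a : R) u : 0 < a -> t <= a ->
  fuzzy_cut (fuzzy_trunc t u) a = fuzzy_cut u a.
Proof.
move=> a0 ta; apply/seteqP; split; first exact: fuzzy_cut_trunc_sub.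
move=> x; rewrite !fuzzy_cutE// /= /fuzzy_trunc => ax.
by rewrite (le_trans ta ax).
Qed.

(** The truncated cut lies inside [[u]_a] and contains the origin, so no point of [[u]_a] is farther
    from it than from the origin. This is the domination used for density. *)
Lemma cut_dist_trunc_le (t a : R) u : 0 < t <= 1 -> star_fuzzy u ->
  0 < a <= 1 ->
  (cut_dist u (fuzzy_trunc t u) a <= cut_dist u fuzzy_origin a)%E.
Proof.
move=> t01 su a01; have st := star_fuzzy_trunc t u t01 su.
have a0 : 0 < a by case/andP: a01.
have u0 := cut_dist_ge0 u fuzzy_origin a su a01.
case E : (cut_dist u fuzzy_origin a) u0 => [r| |]// r0; last by rewrite leey.
have ur : fuzzy_cut u a `<=` [set x | eucl_dist x 0 <= r].
  apply/hausdorff_dist_set1P; first exact: fuzzy_cut_neq0.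
  by rewrite -(fuzzy_cut_origin a a01) -E.
apply/hausdorff_distP; split=> x ux s rs.
  exists 0; first by rewrite fuzzy_cutE//= (star_fuzzy0 _ st); case/andP: a01.
  exact: le_lt_trans (ur _ ux) rs.
exists x; first exact: fuzzy_cut_trunc_sub ux.
by rewrite eucl_distxx (le_lt_trans _ rs).
Qed.

Section dp.
Variable p : R.
Hypothesis p1 : 1 <= p.

Let p0 : 0 < p. Proof. exact: lt_le_trans p1. Qed.

Lemma integral_cut_dist_lty u v : star_fuzzy u -> star_fuzzy v ->
  (fuzzy_dp p u v < +oo)%E ->
  (\int[mu]_(a in `]0%R, 1%R]) poweR (cut_dist u v a) p < +oo)%E.
Proof.
move=> su sv; rewrite (fuzzy_dpE p _ _ su sv).
by apply: lty_poweRy; rewrite invr_eq0 gt_eqF.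
Qed.

(** Almost every cut has finite distance to the origin; any such level [g <= a] gives a bounded cut
    containing [[u]_a]. *)
Lemma S0mp_cut_bounded u (a : R) : S0mp p u -> 0 < a <= 1 ->
  exists r, forall x, a <= u x -> eucl_dist x 0 <= r.
Proof.
move=> /(S0mpP p _)[su uoo] a01; have so := @star_fuzzy_origin R m.
have Ioo := integral_cut_dist_lty _ _ su so uoo.
have H : {ae mu, forall x, 0 < x <= 1 ->
    cut_dist u fuzzy_origin x \is a fin_num}.
  have := poweR_integral_ae_fin_num _ _ _ mu p p1 _ _ (measurable_itv _)
    (measurable_cut_dist _ _ su so) _ Ioo.
  move=> H; apply: filterS (H _) => [x + x01|x]; last first.
    by rewrite /= in_itv/=; exact: cut_dist_ge0.
  by apply; rewrite /= in_itv.
have [g [g0 /andP[_ ga] gfin]] := ae_dense01 _ a 0 H a01 (andP a01).1.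
have g01 : 0 < g <= 1 by rewrite g0 (le_trans ga)//; case/andP: a01.
exists (fine (cut_dist u fuzzy_origin g)) => x ax.
have : (cut_dist u fuzzy_origin g <= (fine (cut_dist u fuzzy_origin g))%:E)%E.
  by rewrite fineK.
rewrite {1}/cut_dist fuzzy_cut_origin// => /hausdorff_dist_set1P; apply.
  exact: fuzzy_cut_neq0.
by rewrite fuzzy_cutE//=; exact: le_trans ax.
Qed.

Lemma S0m_trunc (t : R) u : 0 < t <= 1 -> S0mp p u -> S0m (fuzzy_trunc t u).
Proof.
move=> t01 /[dup] u0 /(S0mpP p _)[su _].
have [f n us s] := star_fuzzy_trunc t u t01 su; split => //.
have [r rP] := S0mp_cut_bounded u t u0 t01.
exists r; split; first exact: num_real.
move=> M rM x; rewrite /fuzzy_cut eqxx => clx /=.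
(* The support of the truncation lies in [[u]_t], which is closed, so taking the closure adds
   nothing outside this bounded cut. *)
have : fuzzy_cut u t x.
  apply: closed_fuzzy_cut; first exact: star_fuzzy_usc.
  apply: closure_subset clx => y /=; rewrite fuzzy_cutE; last by case/andP: t01.
  by rewrite /fuzzy_trunc; case: ifP => //; rewrite ltxx.
rewrite fuzzy_cutE; last by case/andP: t01.
move=> /rP xr; have := ler_norm_eucl_dist x 0; rewrite subr0.
by move=> /le_trans; apply; exact: le_trans (ltW rM).
Qed.

Lemma S0m_dense u (e : R) : S0mp p u -> 0 < e ->
  exists2 v, S0m v & (fuzzy_dp p u v < e%:E)%E.
Proof.
move=> u0 e0; have [su uoo] := iffLR (S0mpP p u) u0.
have so := @star_fuzzy_origin R m.
have Ioo := integral_cut_dist_lty _ _ su so uoo.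
pose t n : R := n.+1%:R^-1.
have t01 n : 0 < t n <= 1 by rewrite invr_gt0 ltr0Sn invf_le1// ler1n.
have sv n := star_fuzzy_trunc (t n) u (t01 n) su.
pose f n a := poweR (cut_dist u (fuzzy_trunc (t n) u) a) p.
have mf n : measurable_fun (`]0, 1] : set R) (f n).
  by apply: measurable_fun_poweR; exact: measurable_cut_dist.
have mg : measurable_fun (`]0, 1] : set R)
    (fun a => poweR (cut_dist u fuzzy_origin a) p).
  by apply: measurable_fun_poweR; exact: measurable_cut_dist.
have [] := @dominated_convergence _ _ _ mu _ (measurable_itv _) f (cst 0%E)
  (fun a => poweR (cut_dist u fuzzy_origin a) p) mf.
- exact: measurable_cst.
- apply/nearW => a; rewrite /= in_itv/= => /andP[a0 a1].
  apply: cvg_near_cst; near=> n.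
  (* From this index on, truncation leaves the cut at level [a] unchanged. *)
  have ta : t n <= a.
    apply: ltW; near: n; exact: (near_infty_natSinv_lt (PosNum a0)).
  rewrite /f /cut_dist fuzzy_cut_trunc// hausdorff_distxx.
    by rewrite poweR0r// gt_eqF.
  by apply: fuzzy_cut_neq0 => //; rewrite a0.
- apply/integrableP; split => //.
  by under eq_integral do rewrite gee0_abs ?poweR_ge0//.
- apply/nearW => a n; rewrite /= in_itv/= => a01.
  rewrite gee0_abs ?poweR_ge0//; apply: le_poweR; first exact: ltW.
    exact: cut_dist_ge0.
  exact: cut_dist_trunc_le.
move=> _ _; rewrite integral0 => If.
have d0 : 0 < (e / 2) `^ p by apply: powR_gt0; rewrite divr_gt0.
have : nbhs (0%E : \bar R) [set x : \bar R | (x < ((e / 2) `^ p)%:E)%E].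
  apply: open_nbhs_nbhs; split; first exact: open_ereal_lt_ereal.
  by rewrite /= lte_fin.
move=> /If[n _ /(_ n (leqnn n))/= /ltW In].
exists (fuzzy_trunc (t n) u); first exact: S0m_trunc.
rewrite (fuzzy_dpE p _ _ su (sv n)).
apply: (@le_lt_trans _ _ (poweR ((e / 2) `^ p)%:E p^-1)).
  apply: le_poweR In; first by rewrite invr_ge0 ltW.
  by apply: integral_ge0 => a _; exact: poweR_ge0.
rewrite poweR_EFin -powRrM divff ?gt_eqF// powRr1; last first.
  by rewrite ltW// divr_gt0.
by rewrite lte_fin; lra.
Unshelve. all: by end_near. Qed.

End dp.
End truncation.

(** * Fuzzy sets with prescribed cuts *)

Section decreasing_families.
Context {R : realType} {m : nat}.
Implicit Types (x y : 'rV[R]_m) (a b : R).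

Lemma rat_vector_approx x (e : R) : 0 < e ->
  exists q : 'rV[rat]_m, eucl_dist x (map_mx ratr q) < e.
Proof.
move=> e0.
have : nbhs x [set y | eucl_dist x y < e] by apply/nbhs_eucl_distP; exists e.
move=> /nbhs_ballP[d /= d0 dP].
have /choice[q qP] : forall i : 'I_m, exists q : rat,
    `|x ord0 i - ratr q| < d.
  move=> i; have [|q] := @rat_in_itvoo R (x ord0 i) (x ord0 i + d).
    by rewrite ltrDl.
  rewrite in_itv/= => /andP[xq qx]; exists q.
  by rewrite distrC gtr0_norm ?subr_gt0// ltrBlDl.
exists (\row_i q i); apply: dP; split => // i j.
by rewrite !mxE (ord1 i) /ball/=.
Qed.

Variable L : R -> set 'rV[R]_m.
Hypothesis L_antitone : forall a b, 0 < a -> a <= b -> L b `<=` L a.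
Hypothesis L_closed : forall a, closed (L a).
Hypothesis L_origin : forall a, 0 < a <= 1 -> L a 0.
Hypothesis L_star : forall a x (l : R), 0 < a -> 0 <= l <= 1 ->
  L a x -> L a (l *: x).

(* [0] is a level of every point, so that the supremum below is never taken
   over the empty set. *)
Definition levels x : set R := [set a | 0 <= a <= 1 /\ (0 < a -> L a x)].

Definition fuzzy_of_cuts x : R := sup (levels x).

Let levels0 x : levels x 0.
Proof. by split; rewrite ?lexx ?ler01// ltxx. Qed.

Let has_sup_levels x : has_sup (levels x).
Proof. by split; [exists 0|exists 1 => a [/andP[]]]. Qed.

Lemma le_fuzzy_of_cuts x a : 0 < a <= 1 -> L a x -> a <= fuzzy_of_cuts x.
Proof.
move=> /andP[a0 a1] Lax; apply: ub_le_sup; first by case: (has_sup_levels x).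
by split; rewrite ?a1 ?ltW.
Qed.

Lemma fuzzy_of_cuts_lt x b : 0 < b -> b < fuzzy_of_cuts x -> L b x.
Proof.
move=> b0 bx; have e0 : 0 < fuzzy_of_cuts x - b by rewrite subr_gt0.
have [a [/andP[a0 a1] La]] := sup_adherent e0 (has_sup_levels x).
rewrite subKr => ba; apply: (L_antitone b a) => //; first exact: ltW.
by apply: La; exact: lt_trans ba.
Qed.

Lemma fuzzy_set_fuzzy_of_cuts : fuzzy_set fuzzy_of_cuts.
Proof.
move=> x; apply/andP; split.
  by apply: ub_le_sup (levels0 x); case: (has_sup_levels x).
by apply: ge_sup => [|a [/andP[]]//]; exists 0.
Qed.

Lemma star_fuzzy_of_cuts : star_fuzzy fuzzy_of_cuts.
Proof.
split; first exact: fuzzy_set_fuzzy_of_cuts.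
- exists 0; apply/eqP; rewrite eq_le.
  have /andP[_ ->] := fuzzy_set_fuzzy_of_cuts 0.
  by apply: le_fuzzy_of_cuts; rewrite ?ltr01 ?lexx//; apply: L_origin;
    rewrite ltr01 lexx.
- apply/upper_semicontinuousP => x c xc.
  have /andP[x0 _] := fuzzy_set_fuzzy_of_cuts x.
  (* For [c <= 1] the midpoint [b] below is a genuine level in []0, 1]]: a point outside the closed
     set [L b] has a neighbourhood outside it, where the value is at most [b]. *)
  have [c1|c1] := ltP 1 c.
    exists 1 => // y _; apply: le_lt_trans c1.
    by have /andP[] := fuzzy_set_fuzzy_of_cuts y.
  pose b := (fuzzy_of_cuts x + c) / 2.
  have b0 : 0 < b by rewrite /b; lra.
  have bc : b < c by rewrite /b; lra.
  have xb : fuzzy_of_cuts x < b by rewrite /b; lra.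
  have nLbx : ~ L b x.
    move=> Lbx; suff : b <= fuzzy_of_cuts x by rewrite leNgt xb.
    by apply: le_fuzzy_of_cuts => //; rewrite b0 (le_trans (ltW bc) c1).
  have : \forall y \near x, ~ L b y.
    by apply: open_nbhs_nbhs; split => //; exact/closed_openC.
  move=> /nbhs_eucl_distP[e e0 eL]; exists e => // y /eL nLby.
  apply: le_lt_trans bc; rewrite leNgt; apply/negP => /fuzzy_of_cuts_lt.
  by move=> /(_ b0).
- move=> y l l01; apply: ge_sup => [|a [a01 La]]; first by exists 0.
  apply: ub_le_sup; first by case: (has_sup_levels (l *: y)).
  by split => // a0; apply: L_star => //; exact: La.
Qed.

(** The supremum need not be attained, so the cut is the left regularization of [L], which may be
    larger than [L a]. *)
Lemma fuzzy_cut_fuzzy_of_cuts a : 0 < a <= 1 ->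
  fuzzy_cut fuzzy_of_cuts a = [set x | forall b, 0 < b < a -> L b x].
Proof.
move=> /andP[a0 a1]; rewrite fuzzy_cutE//; apply/seteqP; split=> x /= ax.
  move=> b /andP[b0 ba]; apply: fuzzy_of_cuts_lt => //.
  exact: lt_le_trans ax.
rewrite leNgt; apply/negP => xa.
have /andP[x0 _] := fuzzy_set_fuzzy_of_cuts x.
have : (fuzzy_of_cuts x + a) / 2 <= fuzzy_of_cuts x.
  by apply: le_fuzzy_of_cuts; [lra|apply: ax; lra].
by lra.
Qed.

(* A jump of the family at [a] is witnessed by a rational ball that meets [L b]
   for every [b < a] but misses [L a]; such a ball determines [a]. *)
Lemma countable_cut_jumps :
  countable [set a | 0 < a <= 1 /\ fuzzy_cut fuzzy_of_cuts a <> L a].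
Proof.
pose S (qn : 'rV[rat]_m * nat) := [set b | 0 < b <= 1 /\
  exists2 y, L b y & eucl_dist (map_mx ratr qn.1) y < qn.2.+1%:R^-1].
apply: (@sub_countable _ _ _ (range (fun qn => sup (S qn)))); last first.
  by apply: card_le_trans (card_image_le _ _) _; exact: countableP.
apply: subset_card_le => a [/[dup] a01 /andP[a0 a1]].
rewrite fuzzy_cut_fuzzy_of_cuts// => neq.
have [x xP nLax] : exists2 x, (forall b, 0 < b < a -> L b x) & ~ L a x.
  apply: contrapT => nx; apply: neq; apply/seteqP; split=> x /= xP.
    by apply: contrapT => nLax; apply: nx; exists x.
  by move=> b /andP[b0 ba]; apply: L_antitone xP => //; exact: ltW.
have : \forall y \near x, ~ L a y.
  by apply: open_nbhs_nbhs; split => //; exact/closed_openC.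
move=> /nbhs_eucl_distP[e e0 eL].
have [n _ /(_ n (leqnn n))/= ne] : \forall n \near \oo, n.+1%:R^-1 < e / 2.
  exact: (near_infty_natSinv_lt (PosNum (divr_gt0 e0 (ltr0Sn _ 1)))).
have [|q xq] := rat_vector_approx x n.+1%:R^-1; first by rewrite invr_gt0.
exists (q, n) => //.
(* The rational ball lies within distance [e] of [x], hence misses [L a] and every smaller [L b].
   With [Sb] this forces [sup (S (q, n))] to be [a]. *)
have Slt b : S (q, n) b -> b <= a.
  move=> [/andP[b0 _] [y Lby /= qy]]; rewrite leNgt; apply/negP => ab.
  apply: (eL y); last by apply: L_antitone Lby => //; exact: ltW.
  apply: le_lt_trans (eucl_dist_triangle (map_mx ratr q) _ _) _.
  by apply: lt_le_trans (ltrD xq qy) _; rewrite (splitr e) lerD// ltW.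
have Sb b : 0 < b < a -> S (q, n) b.
  move=> /[dup] b0a /andP[b0 ba]; split.
    by rewrite b0 (le_trans (ltW ba)).
  by exists x; [exact: xP|rewrite eucl_distC].
apply/eqP; rewrite eq_le; apply/andP; split.
  by apply: ge_sup => //; exists (a / 2); apply: Sb; lra.
rewrite leNgt; apply/negP => Sa.
have hS : has_ubound (S (q, n)) by exists a.
have S2 : a / 2 <= sup (S (q, n)) by apply: ub_le_sup => //; apply: Sb; lra.
have : (sup (S (q, n)) + a) / 2 <= sup (S (q, n)).
  by apply: ub_le_sup => //; apply: Sb; lra.
by lra.
Qed.

End decreasing_families.

(** * Limits of rapidly converging sequences *)

Lemma closed_set_liminf (R : realType) (m : nat) (A : nat -> set 'rV[R]_m) :
  closed (set_liminf A).
Proof.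
apply/closed_eucl_distP => x clx e e0.
have e20 : 0 < e / 2 by rewrite divr_gt0.
have [y Ay xy] := clx _ e20; have [N NP] := Ay _ e20.
exists N => n /NP[z Az yz]; exists z => //.
apply: le_lt_trans (eucl_dist_triangle y _ _) _.
by rewrite (splitr e) ltrD.
Qed.

Section limit.
Context {R : realType} {m : nat}.
Variables (p : R) (u : nat -> 'rV[R]_m -> R).
Hypothesis p1 : 1 <= p.
Hypothesis su : forall n, star_fuzzy (u n).
Hypothesis du : forall n, (fuzzy_dp p (u n) (u n.+1) <= (4 ^- n)%:E)%E.
Local Notation mu := (@lebesgue_measure R).

Let p0 : 0 < p. Proof. exact: lt_le_trans p1. Qed.

Definition cut_liminf a := set_liminf (fun n => fuzzy_cut (u n) a).

Lemma cut_liminf_antitone a b : 0 < a -> a <= b ->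
  cut_liminf b `<=` cut_liminf a.
Proof.
move=> a0 ab x Lx e e0; have [N NP] := Lx e e0; exists N => n /NP[y by_ xy].
exists y => //; move: by_; rewrite !fuzzy_cutE//= ?(lt_le_trans a0)//.
exact: le_trans.
Qed.

Lemma cut_liminf_origin a : 0 < a <= 1 -> cut_liminf a 0.
Proof.
move=> /andP[a0 a1] e e0; exists 0%N => n _; exists 0.
  by rewrite fuzzy_cutE//= star_fuzzy0.
by rewrite eucl_distxx.
Qed.

Lemma cut_liminf_star a x l : 0 < a -> 0 <= l <= 1 ->
  cut_liminf a x -> cut_liminf a (l *: x).
Proof.
move=> a0 l01 Lx e e0; have [N NP] := Lx e e0; exists N => n /NP[y ay xy].
exists (l *: y); last by apply: le_lt_trans xy; exact: eucl_dist_scale.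
move: ay; rewrite !fuzzy_cutE//= => /le_trans; apply.
by have [_ _ _] := su n; apply.
Qed.

Definition fuzzy_limit := fuzzy_of_cuts cut_liminf.

Lemma star_fuzzy_limit : star_fuzzy fuzzy_limit.
Proof.
apply: star_fuzzy_of_cuts.
- exact: cut_liminf_antitone.
- by move=> a; exact: closed_set_liminf.
- exact: cut_liminf_origin.
- exact: cut_liminf_star.
Qed.

Lemma ae_fuzzy_cut_limit : {ae mu, forall a, 0 < a <= 1 ->
  fuzzy_cut fuzzy_limit a = cut_liminf a}.
Proof.
have cD := countable_cut_jumps cut_liminf cut_liminf_antitone
  (fun a => closed_set_liminf _ _ _).
exists [set a | 0 < a <= 1 /\ fuzzy_cut fuzzy_limit a <> cut_liminf a].
split; first by apply: countable_measurable => // a; exact: measurable_set1.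
  exact: countable_lebesgue_measure0.
by move=> a /= /not_implyP.
Qed.

Let f n := cut_dist (u n) (u n.+1).
Let g n a := (((2 ^+ n) `^ p)%:E * poweR (f n a) p)%E.
Let S a := (\sum_(n <oo) g n a)%E.

Let g0 n a : (0 <= g n a)%E.
Proof. by rewrite mule_ge0 ?poweR_ge0// lee_fin powR_ge0. Qed.

Let mg n : measurable_fun (`]0, 1] : set R) (g n).
Proof.
apply: measurable_funeM.
by apply: measurable_fun_poweR; exact: measurable_cut_dist.
Qed.

Let mS : measurable_fun (`]0, 1] : set R) S.
Proof. by apply: ge0_emeasurable_sum => // k x _ _; exact: g0. Qed.

Let S0 a : (0 <= S a)%E.
Proof. by apply: nneseries_ge0 => n _ _; exact: g0. Qed.

Let int_g n : (\int[mu]_(a in `]0%R, 1%R]) g n a <= (2 / (2 ^ n.+1)%:R)%:E)%E.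
Proof.
have mfp : measurable_fun (`]0, 1] : set R) (fun a => poweR (f n a) p).
  by apply: measurable_fun_poweR; exact: measurable_cut_dist.
rewrite (ge0_integralZl_EFin mu (measurable_itv _)
  (fun a _ => poweR_ge0 _ _) mfp (powR_ge0 _ _)).
have If : (\int[mu]_(a in `]0%R, 1%R]) poweR (f n a) p <=
    ((4 ^- n) `^ p)%:E)%E.
  have : (poweR (fuzzy_dp p (u n) (u n.+1)) p <= poweR (4 ^- n)%:E p)%E.
    by apply: le_poweR (du n); [exact: ltW|exact: fuzzy_dp_ge0].
  rewrite (fuzzy_dpE p _ _ (su n) (su n.+1)) -poweRrM mulVf ?gt_eqF//.
  by rewrite poweRe1//; apply: integral_ge0 => a _; exact: poweR_ge0.
apply: (@le_trans _ _ (((2 ^+ n) `^ p)%:E * ((4 ^- n) `^ p)%:E)%E).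
  by apply: lee_wpmul2l If; rewrite lee_fin powR_ge0.
rewrite -EFinM lee_fin -powRM ?invr_ge0 ?exprn_ge0//.
have -> : 2 / (2 ^ n.+1)%:R = 2 ^- n :> R.
  by rewrite natrX exprS invfM mulrA divff// mul1r.
have -> : 2 ^+ n / 4 ^+ n = 2 ^- n :> R.
  rewrite (_ : 4 = 2 * 2 :> R); last by rewrite -natrM.
  by rewrite exprMn invfM mulrA divff ?mul1r// expf_neq0.
have h1 : 2 ^- n <= 1 :> R by rewrite invf_le1 ?exprn_gt0// exprn_ege1// ler1n.
rewrite -[leRHS]powRr1 ?invr_ge0 ?exprn_ge0//.
by apply: ger_powR => //; rewrite h1 invr_gt0 exprn_gt0.
Qed.

Let int_S : (\int[mu]_(a in `]0%R, 1%R]) S a <= 2%:E)%E.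
Proof.
rewrite integral_nneseries//; apply: le_trans (epsilon_trick0 xpredT _).
  apply: lee_nneseries => n *; last exact: int_g.
  by apply: integral_ge0 => a _; exact: g0.
by [].
Qed.

Let cut_dist_limit_le n a : 0 < a <= 1 ->
  fuzzy_cut fuzzy_limit a = cut_liminf a ->
  (poweR (cut_dist fuzzy_limit (u n) a) p <= ((2 / 2 ^+ n) `^ p)%:E * S a)%E.
Proof.
move=> a01 cuta; have n0 : 0 < 2 / 2 ^+ n :> R by rewrite divr_gt0 ?exprn_gt0.
case Sa : (S a) (S0 a) => [s| |]// s0; last first.
  by rewrite gt0_muley ?leey// lte_fin powR_gt0.
rewrite lee_fin in s0.
have fs k : (f k a <= (s `^ p^-1 / 2 ^+ k)%:E)%E.
  have fk0 : (0 <= f k a)%E by exact: cut_dist_ge0.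
  have : (g k a <= s%:E)%E.
    (* The partial sum stops at [k.+1] so that term [k] is its last one. *)
    rewrite -Sa; apply: le_trans (nneseries_lim_ge k.+1 _) => //.
    by rewrite big_nat_recr//= leeDr// sume_ge0.
  rewrite /g -poweR_EFin -poweRM// ?lee_fin ?exprn_ge0// => gs.
  have k0 : 0 < 2 ^+ k :> R by rewrite exprn_gt0.
  have : ((2 ^+ k)%:E * f k a <= (s `^ p^-1)%:E)%E.
    have : (poweR (poweR ((2 ^+ k)%:E * f k a) p) p^-1 <= poweR s%:E p^-1)%E.
      by apply: le_poweR gs; rewrite ?poweR_ge0// invr_ge0 ltW.
    rewrite -poweRrM divff ?gt_eqF// poweRe1 ?poweR_EFin//.
    by rewrite mule_ge0// lee_fin ltW.
  by rewrite EFinM muleC lee_pdivlMr// muleC.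
have H := geometric_set_liminf (fun n => fuzzy_cut (u n) a) _
  (powR_ge0 _ _) fs n.
rewrite /cut_dist cuta.
have -> : (((2 / 2 ^+ n) `^ p)%:E * s%:E =
    poweR (s `^ p^-1 *+ 2 / 2 ^+ n)%:E p)%E.
  rewrite poweR_EFin -EFinM; congr EFin.
  rewrite -(mulr_natr (s `^ p^-1)) -(mulrA (s `^ p^-1)).
  rewrite [in RHS]powRM ?powR_ge0 ?ltW//.
  by rewrite -powRrM mulVf ?gt_eqF// powRr1// mulrC.
apply: le_poweR H; first exact: ltW.
by apply: hausdorff_dist_ge0; exists 0; exact: cut_liminf_origin.
Qed.

Lemma fuzzy_dp_limit n :
  (fuzzy_dp p fuzzy_limit (u n) <= (2 `^ p^-1 * 2 / 2 ^+ n)%:E)%E.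
Proof.
have sl := star_fuzzy_limit.
have n0 : 0 <= 2 / 2 ^+ n :> R by rewrite divr_ge0 ?exprn_ge0.
have : (\int[mu]_(a in `]0%R, 1%R]) poweR (cut_dist fuzzy_limit (u n) a) p <=
    (((2 / 2 ^+ n) `^ p) * 2)%:E)%E.
  rewrite EFinM; apply: (@le_trans _ _
      (((2 / 2 ^+ n) `^ p)%:E * \int[mu]_(a in `]0%R, 1%R]) S a)%E); last first.
    by apply: lee_wpmul2l int_S; rewrite lee_fin powR_ge0.
  rewrite -ge0_integralZl_EFin ?powR_ge0//.
  apply: ae_ge0_le_integral => //.
  - by move=> a _; exact: poweR_ge0.
  - by apply: measurable_fun_poweR; exact: measurable_cut_dist.
  - by move=> a _; rewrite mule_ge0 ?S0// lee_fin powR_ge0.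
  - exact: measurable_funeM.
  have [N [mN N0 NP]] := ae_fuzzy_cut_limit; exists N; split => // a /= nle.
  apply: NP => /= cuta; apply: nle; rewrite in_itv/= => a01.
  by apply: cut_dist_limit_le => //; exact: cuta.
move=> I2; rewrite (fuzzy_dpE p _ _ sl (su n)).
apply: (@le_trans _ _ (poweR (((2 / 2 ^+ n) `^ p) * 2)%:E p^-1)).
  apply: le_poweR I2; first by rewrite invr_ge0 ltW.
  by apply: integral_ge0 => a _; exact: poweR_ge0.
rewrite poweR_EFin lee_fin powRM ?powR_ge0// -powRrM divff ?gt_eqF//.
by rewrite powRr1// mulrC mulrA.
Qed.

End limit.

(** * The completion *)

Lemma ball_metric_spaceE (R : realType) (T : Type) (S : set T)
    (d : T -> T -> \bar R) (dS : metric_on S d) (x : metric_space dS) (e : R) :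
  ball x e = [set y | metric_dist x y < e].
Proof. exact: ballEmdist. Qed.

Section completeness.
Context {R : realType} {m : nat}.
Variable p : R.
Hypothesis p1 : 1 <= p.
Variable dS : metric_on (S0mp (R := R) (m := m) p) (fuzzy_dp p).
Local Notation Y := (metric_space dS).

(** A Cauchy filter contains balls of radius [4 ^- n / 2]. Two consecutive ones meet, so their
    centres form a rapidly converging sequence, whose limit is also the limit of the filter. *)
Lemma S0mp_complete (F : set_system Y) : ProperFilter F -> cauchy F ->
  exists y : Y, F --> y.
Proof.
move=> FF /cauchyP cF.
have /choice[x xP] : forall n, exists x : Y, F (ball x (4 ^- n / 2)).
  by move=> n; apply: cF; rewrite divr_gt0 ?invr_gt0 ?exprn_gt0.
pose u n := metric_val (x n).
have uS n : S0mp p (u n) by exact: metric_valP.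
have su n : star_fuzzy (u n) by have /(S0mpP p (u n))[] := uS n.
have du n : (fuzzy_dp p (u n) (u n.+1) <= (4 ^- n)%:E)%E.
  have [z []] := filter_ex (filterI (xP n) (xP n.+1)).
  rewrite !ball_metric_spaceE/= => xz xz'.
  rewrite -[leLHS](metric_distE (x n) (x n.+1)) lee_fin.
  apply: le_trans (metric_dist_triangle z _ _) _.
  rewrite (metric_dist_sym z) (splitr (4 ^- n)).
  apply: lerD; first exact: ltW.
  apply: le_trans (ltW xz') _; rewrite ler_pM2r ?invr_gt0//.
  by rewrite lef_pV2 ?posrE ?exprn_gt0// ler_eXn2l// ltr1n.
have sw := star_fuzzy_limit u su.
have dw := fuzzy_dp_limit p u p1 su du.
set M := 2 `^ p^-1 * 2 in dw.
have wS : S0mp p (fuzzy_limit u).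
  apply/S0mpP; split => //.
  have so := @star_fuzzy_origin R m.
  apply: le_lt_trans (fuzzy_dp_triangle p p1 _ _ _ sw (su 0%N) so) _.
  apply: lte_add_pinfty; first by apply: le_lt_trans (dw 0%N) _; exact: ltry.
  by have /(S0mpP p (u 0%N))[] := uS 0%N.
pose y : Y := exist _ (fuzzy_limit u) (mem_set wS).
exists y => A /nbhs_ballP[e /= e0 eA].
(* [M / 2 ^+ N] covers the distance from the limit to the centre [x N], and [1 / 2 ^+ N] the radius
   of the ball around it. *)
have [N NP] := half_exp_lt R (M + 1) e e0.
apply: filterS (xP N) => z; rewrite ball_metric_spaceE/= => xz.
apply: eA; rewrite ball_metric_spaceE/=.
apply: le_lt_trans (NP N (leqnn N)).
apply: le_trans (metric_dist_triangle (x N) _ _) _.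
rewrite mulrDl lerD//; first by rewrite -lee_fin metric_distE; exact: dw.
apply: le_trans (ltW xz) _; rewrite mul1r.
apply: (@le_trans _ _ (4 ^- N)).
  by rewrite ler_pdivrMr// ler_peMr ?ler1n// invr_ge0 exprn_ge0.
rewrite lef_pV2 ?posrE ?exprn_gt0// lerXn2r ?nnegrE//.
by rewrite ler_nat.
Qed.

Lemma S0m_dense_metric : dense [set u : Y | S0m (metric_val u)].
Proof.
move=> O [u Ou] oO.
have /nbhs_ballP[e /= e0 eO] : nbhs u O by exact: open_nbhs_nbhs.
have [v vS uv] := S0m_dense p p1 _ e (metric_valP u) e0.
pose y : Y := exist _ v (mem_set (S0m_S0mp p p1 _ vS)).
exists y; split => //; apply: eO; rewrite ball_metric_spaceE/=.
by rewrite -lte_fin metric_distE.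
Qed.

End completeness.

Theorem theorem6p10 (R : realType) (m : nat) (hm : (1 <= m)%N)
    (p : R) (hp : 1 <= p) :
  S0m (R := R) (m := m) `<=` S0mp p /\
  exists dS : metric_on (S0mp (m := m) p) (fuzzy_dp p),
    is_completion [set u : metric_space dS | S0m (metric_val u)].
Proof.
split; first exact: S0m_S0mp.
exists (fuzzy_dp_metric_on p hp); split; first exact: S0mp_complete.
exact: S0m_dense_metric.
Qed.
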